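(* Let $\mathcal{S}\in\mathbb{M}$ be an accept-favour background model with $0\in\mathcal{S}_{\mathrm{acc}}$ (so $-\mathcal{S}_{\mathrm{rej}}\subseteq\mathcal{S}_{\mathrm{acc}}$), and let $\mathcal{M}$ be an accept-favour assessment on $\mathcal{L}$ (so $-\mathcal{M}_{\mathrm{rej}}\subseteq\mathcal{M}_{\mathrm{acc}}$). Then $\mathcal{M}\in\mathbb{M}$ and $\mathcal{S}\subseteq\mathcal{M}$ (i.e., $\mathcal{M}$ is an accept-favour model without confusion dominating $\mathcal{S}$) if and only if all of the following hold: (AF1) $\mathcal{S}\subseteq\mathcal{M}$; (AF2) $0\notin\mathcal{M}_{\mathrm{fav}}$; (AF3) both $\mathcal{M}_{\mathrm{acc}}$ and $\mathcal{M}_{\mathrm{fav}}$ are cones; (AF4) $\mathcal{M}_{\mathrm{acc}}+\mathcal{M}_{\mathrm{fav}}\subseteq\mathcal{M}_{\mathrm{fav}}$.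
   Context: Let $\Omega$ be a non-empty set and let $\mathcal{L}$ be a real linear subspace of the vector space of all real-valued functions (''gambles'') on $\Omega$ with pointwise operations. For $\mathcal{K},\mathcal{K}'\subseteq\mathcal{L}$: $-\mathcal{K}=\{-f:f\in\mathcal{K}\}$; $\mathcal{K}+\mathcal{K}'=\{f+g:f\in\mathcal{K},g\in\mathcal{K}'\}$ (empty if either set is empty); $\mathcal{K}-\mathcal{K}'=\mathcal{K}+(-\mathcal{K}')$; $\overline{\mathcal{K}}=\{\lambda f:\lambda>0,f\in\mathcal{K}\}$; $\operatorname{posi}\mathcal{K}$ is the set of all linear combinations with strictly positive coefficients of non-empty finite families of elements of $\mathcal{K}$ (so $\operatorname{posi}\emptyset=\emptyset$). A cone is a set $\mathcal{K}\subseteq\mathcal{L}$ with $\operatorname{posi}\mathcal{K}=\mathcal{K}$. An assessment is a pair $\mathcal{A}=\langle\mathcal{A}_{\mathrm{acc}};\mathcal{A}_{\mathrm{rej}}\rangle$ of subsets of $\mathcal{L}$; inclusion is component-wise. Its set of favourable gambles is $\mathcal{A}_{\mathrm{fav}}=\mathcal{A}_{\mathrm{acc}}\cap-\mathcal{A}_{\mathrm{rej}}$. An accept-favour assessment is one with $-\mathcal{A}_{\mathrm{rej}}\subseteq\mathcal{A}_{\mathrm{acc}}$. A model without confusion is an assessment $\mathcal{M}$ such that $\mathcal{M}_{\mathrm{acc}}\cap\mathcal{M}_{\mathrm{rej}}=\emptyset$, $\mathcal{M}_{\mathrm{acc}}$ is a cone, and $\overline{\mathcal{M}_{\mathrm{rej}}}\cup(\overline{\mathcal{M}_{\mathrm{rej}}}-\mathcal{M}_{\mathrm{acc}})\subseteq\mathcal{M}_{\mathrm{rej}}$.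 The set of these is $\mathbb{M}$. *)

(* Defs.v *)
From HB Require Import structures.
From mathcomp Require Import all_boot all_order all_algebra.
From mathcomp Require Import all_classical all_reals.

Set Implicit Arguments.
Unset Strict Implicit.
Unset Printing Implicit Defensive.

Import Order.TTheory GRing.Theory Num.Theory.

Local Open Scope ring_scope.
Local Open Scope classical_set_scope.

(* Gambles on Omega have type Omega -> R^o, where R^o is R seen as a module
   over itself, so that they carry the pointwise linear structure. *)

Definition linear_subspace (R : realType) (Omega : Type)
    (L : set (Omega -> R^o)) : Prop :=
  GRing.submod_closed [in L].

Section GambleSets.
Variables (R : realType) (Omega : Type).
Implicit Types K : set (Omega -> R^o).

Definition opp_set K := [set - f | f in K].

Definition add_set K K' := [set f + g | f in K & g in K'].

Definition sub_set K K' := add_set K (opp_set K').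

(* The set written as K with an overline: a positive-scaling hull, not a
   topological closure. *)
Definition scal_hull K :=
  [set lambda *: f | lambda in [set lambda : R | 0 < lambda] & f in K].

(* The index type 'I_n.+1 makes the family non-empty. *)
Definition posi K : set (Omega -> R^o) :=
  [set h | exists (n : nat) (lambda : 'I_n.+1 -> R) (f : 'I_n.+1 -> Omega -> R^o),
     [/\ forall i, 0 < lambda i, forall i, K (f i) &
         h = \sum_(i < n.+1) lambda i *: f i]].

(* A cone may be empty and need not contain 0. *)
Definition cone (L : set (Omega -> R^o)) K := K `<=` L /\ posi K = K.

End GambleSets.

Record assessment (R : realType) (Omega : Type) (L : set (Omega -> R^o)) :=
  Assessment {
    acc : set (Omega -> R^o);
    rej : set (Omega -> R^o);
    acc_sub : acc `<=` L;
    rej_sub : rej `<=` L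
  }.

Section Assessments.
Variables (R : realType) (Omega : Type) (L : set (Omega -> R^o)).
Implicit Types A M : assessment L.

Definition assessment_sub A A' := acc A `<=` acc A' /\ rej A `<=` rej A'.

Definition fav A : set (Omega -> R^o) := acc A `&` opp_set (rej A).

Definition accept_favour A := opp_set (rej A) `<=` acc A.

Definition model_without_confusion M :=
  [/\ acc M `&` rej M = set0,
      cone L (acc M) &
      scal_hull (rej M) `|` sub_set (scal_hull (rej M)) (acc M) `<=` rej M].

End Assessments.

(* Main.v *)
Require Import Defs.
From mathcomp Require Import all_boot all_order all_algebra.
From mathcomp Require Import all_classical all_reals.

(** For an accept-favour assessment, favouring a gamble is the same as
    rejecting its opposite ([fav_accept_favour]), so every condition on the
    rejected gambles can be read as one on the favourable gambles.  Being a cone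
    means being closed under positive scaling and under addition ([coneP]).
    Through [f |-> - f], the closure axiom on rejected gambles says that
    favourable gambles are closed under positive scaling and absorb the addition
    of acceptable gambles (AF4); as favourable gambles are acceptable, this
    includes closure under addition.  Given AF4, some gamble is both accepted
    and rejected exactly when [0] is favourable: [0] is the sum of such an [f]
    and of the favourable [- f]. *)

Import GRing.Theory Num.Theory.

Local Open Scope ring_scope.
Local Open Scope classical_set_scope.

Section Cones.
Set Implicit Arguments.
Variables (R : realType) (Omega : Type).
Implicit Types K L : set (Omega -> R^o).

Lemma posi_scale K (lambda : R) f : 0 < lambda -> K f -> posi K (lambda *: f).
Proof.
move=> lambda0 Kf; exists 0%N, (fun=> lambda), (fun=> f); split=> //.
by rewrite big_ord1.
Qed.

Lemma posi_add K f g : K f -> K g -> posi K (f + g).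
Proof.
move=> Kf Kg.
exists 1%N, (fun=> 1), (fun i => if i == ord0 then f else g); split=> [i|i|].
- exact: ltr01.
- by case: ifP.
- by rewrite big_ord_recl big_ord1 /= !scale1r.
Qed.

Lemma posi_sub K :
  (forall (lambda : R) f, 0 < lambda -> K f -> K (lambda *: f)) ->
  (forall f g, K f -> K g -> K (f + g)) ->
  posi K `<=` K.
Proof.
move=> KZ KD h [n [lambda [f [lambda0 Kf ->]]]].
elim: n lambda f lambda0 Kf => [|n IHn] lambda f lambda0 Kf.
  by rewrite big_ord1; exact: KZ.
rewrite big_ord_recl; apply: KD; first exact: KZ.
by apply: (IHn (fun i => lambda (lift ord0 i)) (fun i => f (lift ord0 i))).
Qed.

Lemma coneP L K : cone L K <->
  [/\ K `<=` L,
      forall (lambda : R) f, 0 < lambda -> K f -> K (lambda *: f) &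
      forall f g, K f -> K g -> K (f + g)].
Proof.
split=> [[KL posiK]|[KL KZ KD]].
  split=> // [lambda f lambda0 Kf|f g Kf Kg]; rewrite -posiK.
  - exact: posi_scale.
  - exact: posi_add.
split=> //; apply/seteqP; split; first exact: posi_sub.
by move=> f Kf; rewrite -[f]scale1r; apply: posi_scale; first exact: ltr01.
Qed.

End Cones.

Section AcceptFavour.
Set Implicit Arguments.
Variables (R : realType) (Omega : Type) (L : set (Omega -> R^o)).
Implicit Types M : assessment L.

Lemma fav_accept_favour M f : accept_favour M -> fav M f <-> rej M (- f).
Proof.
move=> Maf; split=> [[_ [g rejg <-]]|rejf]; first by rewrite opprK.
have oppf : opp_set (rej M) f by exists (- f) => //; rewrite opprK.
by split; first exact: Maf.
Qed.

Lemma rej_accept_favour M f : accept_favour M -> rej M f <-> fav M (- f).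
Proof. by move=> Maf; rewrite fav_accept_favour// opprK. Qed.

Lemma model_rej_scale M (lambda : R) f :
  model_without_confusion M -> 0 < lambda -> rej M f -> rej M (lambda *: f).
Proof.
by move=> [_ _ Mrej] lambda0 rejf; apply: Mrej; left; exists lambda => //; exists f.
Qed.

Lemma model_rej_sub M f g :
  model_without_confusion M -> rej M f -> acc M g -> rej M (f - g).
Proof.
move=> [_ _ Mrej] rejf accg; apply: Mrej; right.
exists f; first by exists 1; [exact: ltr01 | exists f; rewrite ?scale1r].
by exists (- g) => //; exists g.
Qed.

Lemma model_add_fav M f g : accept_favour M -> model_without_confusion M ->
  acc M f -> fav M g -> fav M (f + g).
Proof.
move=> Maf Mmod accf /(fav_accept_favour _ Maf) rejg.
by apply/(fav_accept_favour _ Maf); rewrite opprD addrC; exact: model_rej_sub.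
Qed.

Lemma model_cone_fav M : accept_favour M -> model_without_confusion M ->
  cone L (fav M).
Proof.
move=> Maf Mmod; apply/coneP; split=> [f [accf _]|lambda f lambda0|f g [accf _]].
- exact: acc_sub accf.
- move=> /(fav_accept_favour _ Maf) rejf; apply/(fav_accept_favour _ Maf).
  by rewrite -scalerN; exact: model_rej_scale.
- exact: model_add_fav.
Qed.

End AcceptFavour.

Theorem theorem4p8 (R : realType) (Omega : Type) (hOmega : [set: Omega] !=set0)
    (L : set (Omega -> R^o)) (hL : linear_subspace L)
    (S : assessment L) (hS : model_without_confusion S)
    (hSaf : accept_favour S) (hS0 : acc S 0)
    (M : assessment L) (hMaf : accept_favour M) :
  (model_without_confusion M /\ assessment_sub S M) <->
  [/\ (* AF1 *) assessment_sub S M,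
      (* AF2 *) ~ fav M 0,
      (* AF3 *) cone L (acc M) /\ cone L (fav M) &
      (* AF4 *) add_set (acc M) (fav M) `<=` fav M].
Proof.
split=> [[Mmod SM]|[SM fav0 [cone_acc cone_fav] acc_fav]].
  have [disj cone_acc _] := Mmod; split=> //.
  - move=> favM0; have /(fav_accept_favour _ hMaf) := favM0.
    case: favM0 => acc0 _; rewrite oppr0 => rej0.
    by have : (acc M `&` rej M) 0 by []; rewrite disj.
  - by split=> //; exact: model_cone_fav.
  - by move=> _ [f accf [g favg <-]]; exact: model_add_fav.
have /coneP[_ favZ _] := cone_fav.
have rejZ : scal_hull (rej M) `<=` rej M.
  move=> _ [lambda lambda0 [f /(rej_accept_favour _ hMaf) favf <-]].
  by apply/(rej_accept_favour _ hMaf); rewrite -scalerN; exact: favZ.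
split=> //; split=> //.
  apply/seteqP; split=> // f [accf /(rej_accept_favour _ hMaf) favf].
  by apply: fav0; rewrite -(subrr f); apply: acc_fav; exists f => //; exists (- f).
rewrite subUset; split=> //.
move=> _ [f /rejZ/(rej_accept_favour _ hMaf) favf [_ [g accg <-] <-]].
apply/(rej_accept_favour _ hMaf).
by apply: acc_fav; exists g => //; exists (- f) => //; rewrite opprD opprK addrC.
Qed.
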